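(* Let $(X,d)$ be a finite metric space with cardinality $n=|X|\geq 2$. Then the (normalized) $0$-negative type gap $\Gamma_X^0$ of $(X,d)$ is given by $$\Gamma_X^0 = \frac12\left(\frac{1}{\lfloor \frac n2\rfloor}+\frac{1}{\lceil\frac n2\rceil}\right).$$
   Context: Convention for exponent $p=0$: $d(x,y)^0 = 1$ if $x\neq y$, and $d(x,x)^0=0$. For $p\ge 0$, a metric space $(X,d)$ has $p$-negative type if for all natural numbers $k \geq 2$, all finite subsets $\{x_1,\ldots,x_k\} \subseteq X$ (of $k$ distinct points), and all real numbers $\eta_1,\ldots,\eta_k$ with $\eta_1+\cdots+\eta_k = 0$, one has $\sum_{1\le i,j\le k} d(x_i,x_j)^p\eta_i\eta_j \leq 0$. For positive integers $q,t$, a normalized $(q,t)$-simplex $D(\vec\omega)=[a_j(m_j);b_i(n_i)]_{q,t}$ in $X$ consists of $q+t$ distinct points $a_1,\ldots,a_q,b_1,\ldots,b_t\in X$ together with a vector $\vec\omega=(m_1,\ldots,m_q,n_1,\ldots,n_t)$ of (strictly) positive real numbers such that $m_1+\cdots+m_q = 1 = n_1+\cdots+n_t$. Its $p$-negative type simplex gap is $$\gamma_D^p(\vec\omega) = \sum_{j=1}^{q}\sum_{i=1}^{t} m_j n_i d(a_j,b_i)^p - \sum_{1\le j_1<j_2\le q} m_{j_1}m_{j_2}d(a_{j_1},a_{j_2})^p - \sum_{1\le i_1<i_2\le t} n_{i_1}n_{i_2}d(b_{i_1},b_{i_2})^p.$$ Sums over the empty set are zero. If $(X,d)$ has $p$-negative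 type, its (normalized) $p$-negative type gap is $\Gamma_X^p = \inf_{D(\vec\omega)} \gamma_D^p(\vec\omega)$, the infimum being over all $q,t\ge1$ and all normalized $(q,t)$-simplices in $X$. Every metric space has $0$-negative type, so $\Gamma_X^0$ is defined. *)

(* Defs.v *)
From mathcomp Require Import all_boot all_order all_algebra.
From mathcomp Require Import all_classical all_reals all_analysis.
Set Implicit Arguments.
Unset Strict Implicit.
Unset Printing Implicit Defensive.
Import Order.TTheory GRing.Theory Num.Theory.
Import numFieldNormedType.Exports.
Local Open Scope classical_set_scope.
Local Open Scope ring_scope.

(* d(x, y)^p with the convention d(x, x)^0 = 0; the case distinction is needed
   because the library has 0 `^ 0 = 1. For p > 0 it changes nothing. *)
Definition mdist_pow (R : realType) (X : metricType R) (p : R) (x y : X) : R :=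
  if x == y then 0 else mdist x y `^ p.

Definition negative_type (R : realType) (X : metricType R) (p : R) : Prop :=
  forall (k : nat) (x : 'I_k -> X) (eta : 'I_k -> R),
    (2 <= k)%N -> injective x -> \sum_(i < k) eta i = 0 ->
    \sum_(i < k) \sum_(j < k) mdist_pow p (x i) (x j) * eta i * eta j <= 0.

Record simplex (R : realType) (X : metricType R) (q t : nat) := Simplex {
  vertex_a : 'I_q -> X ;
  vertex_b : 'I_t -> X ;
  weight_a : 'I_q -> R ;
  weight_b : 'I_t -> R ;
  vertex_a_inj : injective vertex_a ;
  vertex_b_inj : injective vertex_b ;
  vertex_ab_neq : forall j i, vertex_a j <> vertex_b i ;
  weight_a_gt0 : forall j, 0 < weight_a j ;
  weight_b_gt0 : forall i, 0 < weight_b i ;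
  weight_a_sum : \sum_(j < q) weight_a j = 1 ;
  weight_b_sum : \sum_(i < t) weight_b i = 1
}.

Definition simplex_gap (R : realType) (X : metricType R) (q t : nat) (p : R)
    (D : simplex X q t) : R :=
  let a := vertex_a D in let b := vertex_b D in
  let m := weight_a D in let n := weight_b D in
  \sum_(j < q) \sum_(i < t) m j * n i * mdist_pow p (a j) (b i)
  - \sum_(j1 < q) \sum_(j2 < q | (j1 < j2)%N)
      m j1 * m j2 * mdist_pow p (a j1) (a j2)
  - \sum_(i1 < t) \sum_(i2 < t | (i1 < i2)%N)
      n i1 * n i2 * mdist_pow p (b i1) (b i2).

(* The infimum is taken in the extended reals, so that it is the true infimum
   with no default value. It is meant for spaces of p-negative type only; for
   p = 0 this is no restriction, see negative_type0 below. *)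
Definition negative_type_gap (R : realType) (X : metricType R) (p : R)
    : \bar R :=
  ereal_inf [set g : \bar R | exists (q t : nat) (D : simplex X q t),
    [/\ (0 < q)%N, (0 < t)%N & g = (simplex_gap p D)%:E]].

Lemma negative_type0 (R : realType) (X : metricType R) : negative_type X 0.
Proof.
move=> k x eta _ x_inj eta0.
suff -> : \sum_(i < k) \sum_(j < k) mdist_pow 0 (x i) (x j) * eta i * eta j
    = - \sum_(i < k) eta i ^+ 2.
  by rewrite oppr_le0 sumr_ge0// => i _; rewrite sqr_ge0.
rewrite -sumrN; apply: eq_bigr => i _.
rewrite (bigD1 i)//= /mdist_pow eqxx !mul0r add0r.
rewrite (eq_bigr (fun j => eta i * eta j)); last first.
  by move=> j ji; rewrite (inj_eq x_inj) eq_sym (negbTE ji) powRr0 mul1r.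
rewrite -big_distrr/=; move: eta0; rewrite (bigD1 i)//= => /eqP.
by rewrite addrC addr_eq0 => /eqP ->; rewrite mulrN expr2.
Qed.

(* Main.v *)
(** At exponent 0 all distances between distinct points equal 1, so the gap of a
    simplex with weights [m], [n] is half of [\sum m_j ^ 2 + \sum n_i ^ 2]. By
    Cauchy-Schwarz this is at least [(1 / q + 1 / t) / 2], with equality for
    uniform weights; under [q + t <= n] the latter is smallest when [q] and [t]
    are as balanced as possible. *)
Require Import Defs.
From mathcomp Require Import all_boot all_order all_algebra.
From mathcomp Require Import all_classical all_reals all_analysis.
From mathcomp Require Import ring lra zify.
Import Order.TTheory GRing.Theory Num.Theory.
Import numFieldNormedType.Exports.
Local Open Scope classical_set_scope.
Local Open Scope card_scope.
Local Open Scope ring_scope.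

Lemma sqr_sum_ltn (R : comNzRingType) (q : nat) (m : 'I_q -> R) :
  (\sum_(j < q) m j) ^+ 2 = \sum_(j < q) m j ^+ 2
    + (\sum_(i < q) \sum_(j < q | (i < j)%N) m i * m j) *+ 2.
Proof.
rewrite expr2 big_distrlr/= mulr2n.
(* Exchanging the sums in one of the two copies makes it range over the indices below the outer one,
   so for fixed [i] the copies together cover all [j] other than [i]. *)
rewrite [X in _ = _ + (_ + X)](exchange_big_dep xpredT)//= -!big_split/=.
apply: eq_bigr => i _; rewrite (bigID (fun j : 'I_q => (i < j)%N))/= addrCA.
congr (_ + _); rewrite (bigD1 i) ?ltnn//= expr2; congr (_ + _).
apply: eq_big => [j|j _]; last exact: mulrC.
by rewrite -leqNgt ltn_neqAle andbC.
Qed.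

Lemma invn_le_sum_sqr (R : realFieldType) (q : nat) (m : 'I_q -> R) :
  \sum_(j < q) m j = 1 -> q%:R^-1 <= \sum_(j < q) m j ^+ 2.
Proof.
move=> m1; have q0 : q%:R != 0 :> R.
  by case: q m m1 => [m|*]; rewrite ?big_ord0 ?pnatr_eq0// => /eqP; rewrite eq_sym oner_eq0.
(* The tangent to the square at the mean [1/q]; summing over [j] gives [2/q - 1/q]. *)
have qm (j : 'I_q) : q%:R^-1 * 2 * m j - q%:R^-1 ^+ 2 <= m j ^+ 2.
  by have := sqr_ge0 (m j - q%:R^-1); rewrite sqrrB; lra.
apply: le_trans (ler_sum _ (fun j _ => qm j)).
rewrite sumrB -mulr_sumr m1 mulr1 sumr_const card_ord -[X in _ - X]mulr_natr expr2 mulfVK//.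
by lra.
Qed.

(** With [A] and [B] the sums of squared weights, the cross term is [1] and the two inner sums are
    [(1 - A)/2] and [(1 - B)/2]. *)
Lemma simplex_gap0 (R : realType) (X : metricType R) (q t : nat)
    (D : simplex X q t) :
  simplex_gap 0 D = 2^-1 * (\sum_(j < q) weight_a D j ^+ 2
                            + \sum_(i < t) weight_b D i ^+ 2).
Proof.
have d0 (x y : X) : x <> y -> mdist_pow 0 x y = 1.
  by move=> /eqP/negbTE xy; rewrite /mdist_pow xy powRr0.
have inner (s : nat) (x : 'I_s -> X) (w : 'I_s -> R) : injective x ->
    \sum_(i < s) w i = 1 ->
    \sum_(i < s) \sum_(j < s | (i < j)%N) w i * w j * mdist_pow 0 (x i) (x j)
    = 2^-1 * (1 - \sum_(i < s) w i ^+ 2).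
  move=> x_inj w1; have := sqr_sum_ltn _ _ w; rewrite w1.
  have -> : \sum_(i < s) \sum_(j < s | (i < j)%N) w i * w j * mdist_pow 0 (x i) (x j)
      = \sum_(i < s) \sum_(j < s | (i < j)%N) w i * w j.
    apply: eq_bigr => i _; apply: eq_bigr => j ij.
    by rewrite d0 ?mulr1// => /x_inj eij; rewrite eij ltnn in ij.
  by lra.
rewrite /simplex_gap (inner _ _ _ (@vertex_a_inj _ _ _ _ D) (weight_a_sum D)).
rewrite (inner _ _ _ (@vertex_b_inj _ _ _ _ D) (weight_b_sum D)).
have -> : \sum_(j < q) \sum_(i < t) weight_a D j * weight_b D i *
    mdist_pow 0 (vertex_a D j) (vertex_b D i) = 1.
  rewrite -[RHS]mulr1 -{1}(weight_a_sum D) -(weight_b_sum D) big_distrlr/=.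
  apply: eq_bigr => j _; apply: eq_bigr => i _.
  by rewrite d0 ?mulr1//; exact: vertex_ab_neq.
by lra.
Qed.

Lemma addn_inv_half_le (R : realFieldType) (q t n : nat) :
  (0 < q)%N -> (0 < t)%N -> (q + t <= n)%N ->
  (n./2)%:R^-1 + (uphalf n)%:R^-1 <= q%:R^-1 + t%:R^-1 :> R.
Proof.
move=> q0 t0 qtn.
have [qn Dn] : (q < n)%N /\ (n = n./2 + uphalf n)%N by split; lia.
(* Enlarging [t] to [n - q] makes both sides of the form [n / (a b)] with [a + b = n], so only the
   products need comparing. *)
apply: (@le_trans _ _ (q%:R^-1 + (n - q)%:R^-1)); last first.
  by rewrite lerD2l lef_pV2 ?posrE ?ltr0n ?ler_nat//; lia.
have invD (a b : nat) : (0 < a)%N -> (0 < b)%N ->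
    a%:R^-1 + b%:R^-1 = (a + b)%:R / (a * b)%:R :> R.
  move=> a0 b0; rewrite natrD natrM; field.
  by rewrite !pnatr_eq0 -!lt0n b0.
rewrite !invD -?Dn ?subnKC//; try lia.
rewrite ler_wpM2l// lef_pV2 ?posrE ?ltr0n ?muln_gt0 ?ler_nat; try lia.
have : (n./2 <= uphalf n <= n./2.+1)%N by lia.
move: Dn; move: (n./2) (uphalf n) => k l nkl /andP[kl lk].
have [r Dr] : exists r, n = (q + r)%N by exists (n - q)%N; lia.
rewrite {1}Dr addKn.
(* Since [k + l = q + r], one has [k l - q r = (k - q)(l - q)]. This is nonnegative because
   [k <= l <= k + 1] leaves no integer strictly between [k] and [l]. *)
have [qk|qk] := leqP q k.
  have -> : r = (l + (k - q))%N by lia.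
  by nia.
have -> : q = (l + (q - l))%N by lia.
by nia.
Qed.

(** [card_bijP] gives a bijection between the full sets seen as subtypes; [toT] and [val] carry it
    over to the types themselves. *)
Lemma card_eq_II_bij (T : Type) (n : nat) :
  [set: T] #= `I_n -> exists h : T -> 'I_n, bijective h.
Proof.
move=> /card_eq_trans/(_ card_II)/card_bijP[h [g hK gK]].
pose toT (U : Type) (x : U) : [set: U] := SigSub (mem_set (I : [set: U] x)).
have toTK (U : Type) (s : [set: U]) : toT U (val s) = s by exact: val_inj.
exists (fun x => val (h (toT _ x))), (fun i => val (g (toT _ i))) => y.
  by rewrite toTK hK.
by rewrite toTK gK.
Qed.

(** The [q + t] vertices are distinct, so listing them injects the disjoint sum of the index types
    into ['I_n]. *)
Lemma simplex_vertices_le (R : realType) (X : metricType R) (n q t : nat)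
    (D : simplex X q t) : [set: X] #= `I_n -> (q + t <= n)%N.
Proof.
move=> /card_eq_II_bij[h /bij_inj h_inj].
pose v (s : 'I_q + 'I_t) := h (match s with
  | inl j => vertex_a D j | inr i => vertex_b D i end).
suff v_inj : injective v by have := leq_card v v_inj; rewrite card_sum !card_ord.
move=> [j|i] [j'|i'] /h_inj => [/vertex_a_inj -> //|||/vertex_b_inj -> //].
- by move=> /vertex_ab_neq.
- by move=> /esym/vertex_ab_neq.
Qed.

Lemma uniform_simplex (R : realType) (X : metricType R) (q t : nat)
    (x : 'I_(q + t) -> X) : injective x -> (0 < q)%N -> (0 < t)%N ->
  exists D : simplex X q t,
    simplex_gap 0 D = 2^-1 * (q%:R^-1 + t%:R^-1).
Proof.
move=> x_inj q0 t0.
have w_gt0 (s : nat) : (0 < s)%N -> forall j : 'I_s, 0 < s%:R^-1 :> R.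
  by move=> s0 _; rewrite invr_gt0 ltr0n.
have w_sum (s : nat) : (0 < s)%N -> \sum_(j < s) s%:R^-1 = 1 :> R.
  by move=> s0; rewrite sumr_const card_ord -[LHS]mulr_natr mulVf// pnatr_eq0 -lt0n.
have ab_neq (j : 'I_q) (i : 'I_t) : x (lshift t j) <> x (rshift q i).
  by move=> /x_inj/eqP; rewrite eq_lrshift.
exists (Simplex (inj_comp x_inj (@lshift_inj q t)) (inj_comp x_inj (@rshift_inj q t))
  ab_neq (w_gt0 q q0) (w_gt0 t t0) (w_sum q q0) (w_sum t t0)).
rewrite simplex_gap0/=; congr (_ * (_ + _)).
  by under eq_bigr do rewrite expr2; rewrite -mulr_sumr w_sum// mulr1.
by under eq_bigr do rewrite expr2; rewrite -mulr_sumr w_sum// mulr1.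
Qed.

Theorem theorem3p2 (R : realType) (X : metricType R) (n : nat)
    (hX : [set: X] #= `I_n) (hn : (2 <= n)%N) :
  negative_type_gap X 0
    = (2^-1 * ((n./2)%:R^-1 + (uphalf n)%:R^-1))%:E.
Proof.
apply/eqP; rewrite eq_le; apply/andP; split.
  (* Upper bound: all points of [X] are split into two halves with uniform weights. Both halves are
     nonempty because [2 <= n]. *)
  have [x x_inj] : exists x : 'I_(n./2 + uphalf n) -> X, injective x.
    have -> : (n./2 + uphalf n = n)%N by lia.
    have [h [g hK gK]] := card_eq_II_bij _ _ hX.
    by exists g; exact: can_inj gK.
  have [||D <-] := uniform_simplex _ _ _ _ _ x_inj; [lia..|].
  by apply: ereal_inf_lbound; exists n./2, (uphalf n), D; split=> //; lia.
(* Lower bound, for an arbitrary simplex: first balance the sizes, then bound each sum of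
   squares. *)
apply: le_ereal_inf_tmp => _ [q [t [D [q0 t0 ->]]]].
rewrite lee_fin simplex_gap0 ler_wpM2l//.
apply: le_trans (addn_inv_half_le _ _ _ _ q0 t0 (simplex_vertices_le _ _ _ _ _ D hX)) _.
by apply: lerD; apply: invn_le_sum_sqr; [exact: weight_a_sum|exact: weight_b_sum].
Qed.
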